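(* For every sufficiently large $N$ there is a graph $G$ on $N$ vertices with minimum degree at least $2^{-8}N$ whose edges cannot be covered by $\frac12\log_2 N$ subgraphs each of diameter at most $4$.
   Context: The diameter of a connected graph is the maximum distance between two vertices; a disconnected graph has diameter $\infty$. *)

(* Defs.v *)
From HB Require Import structures.
From mathcomp Require Import all_boot all_order all_algebra.
From mathcomp Require Import all_classical all_reals all_analysis.

Set Implicit Arguments.
Unset Strict Implicit.
Unset Printing Implicit Defensive.

Import Order.TTheory GRing.Theory Num.Theory.

Local Open Scope classical_set_scope.
Local Open Scope ring_scope.

(* The vertex set is a subset of an ambient finite type, so that a graph and
   its subgraphs, which may have fewer vertices, are objects of one type. *)
Record graph (T : finType) := Graph {
  vset : {set T};
  adj : rel T;
  adj_sym : symmetric adj;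
  adj_irr : irreflexive adj;
  adj_vset : forall x y, adj x y -> (x \in vset) && (y \in vset)
}.

Definition subgraph (T : finType) (H G : graph T) : Prop :=
  vset H \subset vset G /\ subrel (adj H) (adj G).

Definition degree (T : finType) (G : graph T) (x : T) : nat :=
  #|[set y : T | adj G x y]%SET|.

(* Degrees never exceed #|vset G|, so this default value does not affect the
   minimum over a nonempty vertex set. *)
Definition min_degree (T : finType) (G : graph T) : nat :=
  \big[minn/#|vset G|]_(x in vset G) degree G x.

(* Equal to +oo when no walk joins x to y. *)
Definition dist (R : realType) (T : finType) (G : graph T) (x y : T) : \bar R :=
  ereal_inf [set (size p)%:R%:E | p in
              [set p : seq T | path (adj G) x p /\ last x p = y]].

(* Distances are measured inside G itself, and are nonnegative, so the default
   value 0 only matters for the graph without vertices. *)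
Definition diam (R : realType) (T : finType) (G : graph T) : \bar R :=
  \big[Order.max/0%E]_(x in vset G) \big[Order.max/0%E]_(y in vset G)
    dist R G x y.

Definition covers_edges (T : finType) (G : graph T) (k : nat)
    (H : 'I_k -> graph T) : Prop :=
  forall x y, adj G x y -> exists i, adj (H i) x y.

Definition log2 (R : realType) (x : R) : R := ln x / ln 2.

(* Main.v *)
(* Let [4 * 2^d <= N < 8 * 2^d]. On each of two sides, join the sets
   [s] in [{0, ..., d-1}] with [16 * #|s| >= d] to the elements they contain, and
   join the two copies of each set by a crossing edge; [G] is a blow-up of this
   graph on [N] vertices. If a subgraph of diameter at most 4 contains crossing
   edges of [s] and [t], the walk from [s] on one side to [t] on the other shows
   that [s] and [t] meet. So [k] such subgraphs covering [G] yield [k]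
   intersecting families covering all these sets. By Kleitman's theorem (a
   consequence of Harris's correlation inequality for down-sets) they miss at
   least [2^(d-k)] subsets, which for [4^k <= N] is more than the number of sets
   with [16 * #|s| < d]. *)

Require Import Defs.
From HB Require Import structures.
From mathcomp Require Import all_boot all_order all_algebra.
From mathcomp Require Import all_classical all_reals all_analysis.
From mathcomp Require Import zify.

Set Implicit Arguments.
Unset Strict Implicit.
Unset Printing Implicit Defensive.

Import Order.TTheory GRing.Theory Num.Theory.

Local Open Scope classical_set_scope.
Local Open Scope ring_scope.

(** * Counting in the cube *)

(* Subsets of [{0, ..., d-1}] are encoded by their characteristic bit sequences. *)
Fixpoint cube (d : nat) : seq bitseq :=
  if d is d'.+1 then map (cons false) (cube d') ++ map (cons true) (cube d')
  else [:: [::]].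

Lemma size_cube d : size (cube d) = (2 ^ d)%N.
Proof. by elim: d => //= d IH; rewrite size_cat !size_map IH expnS; lia. Qed.

Lemma mem_cube d s : (s \in cube d) = (size s == d).
Proof.
elim: d s => [|d IH] [|b s] //=; rewrite mem_cat.
  by apply/orP => -[] /mapP[].
have inj (c : bool) : injective (cons c) by move=> x y [].
by case: b; rewrite (mem_map (inj _)) IH eqSS; case: (size s == d);
  rewrite ?orbT ?orbF //; apply/negP => /mapP[].
Qed.

Lemma cube_uniq d : uniq (cube d).
Proof.
elim: d => //= d IH; rewrite cat_uniq !map_inj_uniq ?IH /= => [|x y []|x y []] //.
by rewrite andbT; apply/hasPn => _ /mapP[x _ ->]; apply/mapP => -[].
Qed.

Lemma count_cubeS (P : pred bitseq) d :
  count P (cube d.+1) =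
  (count (P \o cons false) (cube d) + count (P \o cons true) (cube d))%N.
Proof. by rewrite /= count_cat !count_map. Qed.

Lemma count_cube_negb (P : pred bitseq) d :
  count (P \o map negb) (cube d) = count P (cube d).
Proof.
elim: d P => [|d IH] P //.
by rewrite !count_cubeS addnC -(IH (P \o cons false)) -(IH (P \o cons true)).
Qed.

Lemma count_cube_nth d i :
  (i < d)%N -> (count (fun s => nth false s i) (cube d)).*2 = (2 ^ d)%N.
Proof.
elim: d i => [|d IH] [|i] // ltid; rewrite count_cubeS /comp /=.
  by rewrite count_pred0 count_predT size_cube expnS mul2n.
by rewrite doubleD IH // expnS; lia.
Qed.

(** * Down-sets and Harris's inequality *)

Definition bits_le (s t : bitseq) : bool := all2 implb s t.

Lemma bits_le_refl : reflexive bits_le.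
Proof. by elim=> [|[] s IH]. Qed.

Lemma bits_le_trans : transitive bits_le.
Proof.
elim=> [|b t IH] [|a s] [|c u] //= /andP[ab st] /andP[bc tu].
by apply/andP; split; [case: a b c ab bc {st tu} => [] [] [] | apply: IH st tu].
Qed.

Lemma bits_le_nth s t i : bits_le s t -> nth false s i -> nth false t i.
Proof.
elim: s t i => [|a s IH] [|b t] //= [|i] /andP[ab /IH st] //=; last exact: st.
by case: a b ab => [] [].
Qed.

Definition downset (A : pred bitseq) : Prop :=
  forall s t, bits_le s t -> A t -> A s.

Lemma downset_cons A b : downset A -> downset (A \o cons b).
Proof. by move=> dA s t st; apply: dA; rewrite /bits_le /= implybb. Qed.

(** Split on the first bit: in a down-set the half with [false] is the larger, so
    [(a0 - a1) * (b0 - b1) >= 0], that is [(a0 + a1) * (b0 + b1) <= 2 * (a0 * b0 + a1 * b1)].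
    Induction bounds the last two products. *)
Lemma harris d (A B : pred bitseq) : downset A -> downset B ->
  (count A (cube d) * count B (cube d) <= 2 ^ d * count (predI A B) (cube d))%N.
Proof.
elim: d A B => [|d IH] A B dA dB; first by rewrite /=; case: (A _) (B _) => [] [].
have le10 C : downset C ->
    (count (C \o cons true) (cube d) <= count (C \o cons false) (cube d))%N.
  by move=> dC; apply: sub_count => s; apply: dC; exact: bits_le_refl.
have IHb b := IH _ _ (downset_cons (b := b) dA) (downset_cons (b := b) dB).
move: (le10 _ dA) (le10 _ dB) (IHb false) (IHb true).
rewrite !count_cubeS expnS.
rewrite (_ : predI A B \o cons false = predI (A \o cons false) (B \o cons false)) //.
rewrite (_ : predI A B \o cons true = predI (A \o cons true) (B \o cons true)) //.
move: (count _ _) (count _ _) (count _ _) (count _ _) (count _ _) (count _ _).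
move=> a1 a0 b1 b0 c0 c1 a10 b10 h0 h1.
move: (2 ^ d)%N h0 h1 => m h0 h1.
nia.
Qed.

(** By [harris], intersecting with a further down-set of density at least 1/2 at most halves the
    density. *)
Lemma harris_all d (As : seq (pred bitseq)) :
  (forall A, List.In A As ->
     downset A /\ (2 ^ d <= (count A (cube d)).*2)%N) ->
  (2 ^ d <= 2 ^ size As * count (fun s => all (fun A : pred bitseq => A s) As) (cube d))%N.
Proof.
move=> H; suff [] : downset (fun s => all (fun A : pred bitseq => A s) As) /\
  (2 ^ d <= 2 ^ size As * count (fun s => all (fun A : pred bitseq => A s) As)
     (cube d))%N by [].
elim: As H => [|A As IH] H.
  by split=> //=; rewrite count_predT size_cube mul1n.
have [dA cA] := H A (or_introl erefl).
have [dAs cAs] := IH (fun B BAs => H B (or_intror BAs)).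
split=> [s t st /= /andP[/(dA _ _ st) -> /(dAs _ _ st)] //|].
rewrite /= expnS; move: (harris d dA dAs).
rewrite /predI /=.
have := expn_gt0 2 d.
move: cA cAs; set a := count A _; set b := count _ _; set c := count _ _.
move: (2 ^ d)%N (2 ^ size As)%N => m n cA cAs m0 abc.
rewrite -(leq_pmul2l (m := m)) //.
have : (m * m <= a.*2 * (n * b))%N by exact: leq_mul.
have : (2 * n * (a * b) <= 2 * n * (m * c))%N by rewrite leq_mul2l abc orbT.
nia.
Qed.

(** * Intersecting families and Kleitman's theorem *)

Definition intersecting (d : nat) (F : pred bitseq) : Prop :=
  forall s t, size s = d -> size t = d -> F s -> F t ->
  exists i, nth false s i && nth false t i.

(** The up-closure [U i] of [F i] is still intersecting, so it never contains both a set and its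
    complement. Hence [predC (U i)] is a down-set of density at least 1/2, and [harris_all]
    applies. *)
Lemma kleitman d k (F : 'I_k -> pred bitseq) :
  (forall i, intersecting d (F i)) ->
  (2 ^ d <= 2 ^ k * count (fun s => [forall i, ~~ F i s]) (cube d))%N.
Proof.
move=> intF.
pose U i s := has (fun s' => F i s' && bits_le s' s) (cube d).
have := @harris_all d [seq (predC (U i) : pred bitseq) | i <- enum 'I_k].
rewrite size_map size_enum_ord => /(_ _)/leq_trans; apply.
  move=> A /List.in_map_iff[i [<- _]]; split.
    move=> s t st; apply: contra => /hasP[s' s'd /andP[Fs' le's]].
    by apply/hasP; exists s' => //; rewrite Fs' (bits_le_trans le's st).
  rewrite -addnn -{1}(size_cube d) -[X in (_ <= X + _)%N](count_cube_negb (predC (U i))).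
  rewrite -count_predUI (leq_trans _ (leq_addr _ _)) // -count_predT.
  apply/eq_leq/eq_in_count => s _; rewrite /predU /= -negb_and.
(* Here [s1] lies in the complement of [s] and [s2] in [s], so they cannot share an element. *)
apply/esym/negP => /andP[/hasP[s1]].
  rewrite mem_cube => /eqP sz1 /andP[F1 le1] /hasP[s2].
  rewrite mem_cube => /eqP sz2 /andP[F2 le2].
  have [j /andP[/(bits_le_nth le1) j1 /(bits_le_nth le2) j2]] := intF i _ _ sz1 sz2 F1 F2.
  have [ltj|gej] := ltnP j (size s); last by rewrite nth_default in j2.
  by rewrite (nth_map false) ?j2 // in j1.
rewrite leq_mul2l; apply/orP; right.
rewrite -!size_filter uniq_leq_size ?filter_uniq ?cube_uniq // => s.
rewrite !mem_filter => /andP[/allP allU sd]; rewrite sd andbT.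
apply/forallP => i; apply/negP => Fis.
have /= := allU (predC (U i)) (map_f _ (mem_enum _ i)).
by move/negP; apply; apply/hasP; exists s; rewrite ?Fis ?bits_le_refl.
Qed.

(** * Sparse sets are few *)

(* Weight each set [s] by [16 ^ (d - #|s|)]: the total weight is [17 ^ d]. *)
Lemma count_cube_small d t :
  (count (fun s => count id s <= t)%N (cube d) * 16 ^ d <= 16 ^ t * 17 ^ d)%N.
Proof.
elim: d t => [|d IH] t; first by rewrite /= addn0 !muln1 expn_gt0.
pose small u := count (fun s => count id s <= u)%N (cube d).
have -> : count (fun s => count id s <= t)%N (cube d.+1) =
    (small t + if t is u.+1 then small u else 0)%N.
  rewrite count_cubeS; congr addn; case: t => [|t] //.
  by rewrite (@eq_count _ _ pred0) ?count_pred0.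
case: t => [|t]; first by have := IH 0%N; rewrite -/(small _) !expnS expn0; lia.
by have := IH t; have := IH t.+1; rewrite -/(small _) -/(small _) !expnS; lia.
Qed.

Lemma two_pow_lt_three_pow d : (12 <= d)%N -> (64 * 2 ^ d < 3 ^ d)%N.
Proof.
move=> d12; have ltb : (64 * 2 ^ 12 < 3 ^ 12)%N.
  (* [64 * 2 ^ 12 = 8 ^ 6 < 9 ^ 6 = 3 ^ 12]. *)
  have -> : 64%N = (2 ^ 6)%N by [].
  by rewrite -expnD (expnM 2 3 6) (expnM 3 2 6) ltn_exp2r.
rewrite -(subnKC d12) !expnD mulnA; move: ltb.
move: (64 * 2 ^ 12)%N (3 ^ 12)%N => a b ltab.
apply: (leq_trans (n := b * 2 ^ (d - 12))).
  by rewrite ltn_pmul2r ?expn_gt0.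
by rewrite leq_mul2l; apply/orP; right; case: (d - 12)%N => // e; rewrite leq_exp2r.
Qed.

(** Let [c] count the sets of at most [d / 16] elements. If the bound fails, [4 ^ k < 8 * 2 ^ d]
    forces [c ^ 2 >= 2 ^ d / 8], while [count_cube_small] gives
    [c <= 16 ^ (d / 16) * (17 / 16) ^ d]. In fourth powers, [(2 * (16 / 17) ^ 4) ^ d <= 64], which
    is false for [d >= 12]. *)
Lemma count_cube_sparse d k :
  (12 <= d)%N -> (4 ^ k < 2 ^ (d + 3))%N ->
  (2 ^ k * count (fun s => 16 * count id s < d)%N (cube d) < 2 ^ d)%N.
Proof.
move=> d12 kd; rewrite ltnNge; apply/negP => H.
have := count_cube_small d (d %/ 16).
have : (count (fun s => 16 * count id s < d) (cube d) <=
        count (fun s => count id s <= d %/ 16) (cube d))%N.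
  by apply: sub_count => s /=; lia.
move: H; set a := count _ _; set c := count _ _ => H ac hc.
have {H ac} h1 : (2 ^ d <= 2 ^ k * c)%N.
  by apply: leq_trans H _; rewrite leq_mul2l ac orbT.
have h2 : (2 ^ d <= 8 * c ^ 2)%N.
  rewrite -(leq_pmul2l (m := 2 ^ d)) ?expn_gt0 //.
  have := leq_mul h1 h1.
  have -> : (2 ^ k * c * (2 ^ k * c) = 4 ^ k * c ^ 2)%N.
    by rewrite mulnACA -expnMn mulnn.
  move/leq_trans; apply; rewrite mulnA leq_mul2r; apply/orP; right.
  by rewrite (_ : 8 = 2 ^ 3)%N // -expnD ltnW.
(* The fourth power of [16 ^ (d %/ 16)] is at most [2 ^ d], which removes the rounding. *)
have h3 : ((2 ^ d) ^ 2 * (16 ^ d) ^ 4 <= 64 * 2 ^ d * (17 ^ d) ^ 4)%N.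
  have c4 : ((2 ^ d) ^ 2 <= 64 * c ^ 4)%N.
    rewrite (_ : 64 * c ^ 4 = (8 * c ^ 2) ^ 2)%N; first by rewrite leq_exp2r.
    by rewrite expnMn -expnM.
  have t4 : ((16 ^ (d %/ 16)) ^ 4 <= 2 ^ d)%N.
    have p16 e : (16 ^ e = 2 ^ (4 * e))%N by rewrite expnM.
    by rewrite p16 -expnM leq_pexp2l //; lia.
  have hc4 : ((c * 16 ^ d) ^ 4 <= (16 ^ (d %/ 16) * 17 ^ d) ^ 4)%N.
    by rewrite leq_exp2r.
  move: hc4; rewrite !expnMn => hc4.
  apply: (@leq_trans (64 * c ^ 4 * (16 ^ d) ^ 4)); first by rewrite leq_mul2r c4 orbT.
  rewrite -(mulnA 64 (c ^ 4)%N) -(mulnA 64 (2 ^ d)%N) leq_mul2l; apply/orP; right.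
  by apply: leq_trans hc4 _; rewrite leq_mul2r t4 orbT.
(* [(17/16)^2 <= 8/7] gives [2 * (16/17)^4 >= 98/64 > 3/2]. *)
have h4 : (7 ^ d * (17 ^ d) ^ 2 <= 8 ^ d * (16 ^ d) ^ 2)%N.
  by rewrite -!(expnAC _ 2) -!expnMn leq_exp2r //; lia.
have h5 : (2 ^ d * 7 ^ d * 7 ^ d <= 64 * 8 ^ d * 8 ^ d)%N.
  have := leq_mul h4 h4.
  have := expn_gt0 2 d; have := expn_gt0 16 d; move: h3.
  set p := (2 ^ d)%N; set A := (16 ^ d)%N; set B := (17 ^ d)%N.
  set u := (7 ^ d)%N; set v := (8 ^ d)%N => h3 /= A0 p0 h44.
  rewrite -(leq_pmul2l (m := p * A ^ 4)); last by rewrite muln_gt0 p0 expn_gt0 A0.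
  have := leq_mul h3 (leqnn (u * u)%N).
  have : (64 * p * (u * B ^ 2 * (u * B ^ 2)) <= 64 * p * (v * A ^ 2 * (v * A ^ 2)))%N.
    by rewrite leq_mul2l h44 orbT.
  rewrite !expnS !expn0 !muln1; clear; lia.
have h6 : (3 ^ d * 32 ^ d <= 64 * 2 ^ d * 32 ^ d)%N.
  rewrite -mulnA -!expnMn; move: h5; rewrite -!mulnA -!expnMn.
  by apply: leq_trans; rewrite leq_exp2r //; lia.
move: h6; rewrite leq_pmul2r ?expn_gt0 // => h6.
by have := leq_trans (two_pow_lt_three_pow d12) h6; rewrite ltnn.
Qed.

(** * Counting along residue classes *)

Lemma count_iota_modn (s : bitseq) m d : size s = d ->
  count (fun q => nth false s (q %% d)) (iota 0 (m * d)) = (m * count id s)%N.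
Proof.
move=> sz; elim: m => // m IH.
rewrite mulSnr iotaD count_cat IH mulSnr add0n; congr addn.
rewrite -[(m * d)%N]addn0 iotaDl count_map.
rewrite -[in RHS](mkseq_nth false s) /mkseq count_map sz.
apply: eq_in_count => q; rewrite mem_iota => /= qd.
by rewrite modnMDl modn_small.
Qed.

(** Serves to bound a degree below by the neighbours in one residue class modulo 4, on which [q]
    maps injectively to [4 * q + c]. *)
Lemma card_ord_count N M c (Q : pred nat) : (c < 4)%N -> (4 * M <= N)%N ->
  (count (fun q => Q (4 * q + c)) (iota 0 M) <= #|[set v : 'I_N | Q v]%SET|)%N.
Proof.
move=> c4 MN; rewrite cardsE -sum1_card.
rewrite -(big_mkord Q (fun=> 1%N)) sum1_count /index_iota subn0 -[leqRHS]size_filter.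
rewrite -size_filter -(size_map (fun q => 4 * q + c)%N) uniq_leq_size //.
  rewrite map_inj_uniq ?filter_uniq ?iota_uniq // => x y; lia.
move=> _ /mapP[q + ->]; rewrite !mem_filter !mem_iota => /andP[-> qM] /=; lia.
Qed.

(** * Labels and short walks between the sides *)

(* [(b, inl s)] is the copy of the set [s] on side [b], and [(b, inr i)] the
   copy of the element [i] on side [b]. *)
Definition label : Type := (bool * (bitseq + nat))%type.

Definition label_adj (x y : label) : bool :=
  match x.2, y.2 with
  | inl s, inl t => (x.1 != y.1) && (s == t)
  | inl s, inr i | inr i, inl s => (x.1 == y.1) && nth false s i
  | inr _, inr _ => false
  end.

Lemma label_adj_sym : symmetric label_adj.
Proof.
by move=> [b [s|i]] [c [t|j]]; rewrite /label_adj //= (eq_sym b) 1?(eq_sym s).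
Qed.

Lemma label_adj_irr : irreflexive label_adj.
Proof. by move=> [b [s|i]]; rewrite /label_adj //= eqxx. Qed.

(* A walk of length at most 4 between the sides has odd length, so at most 3:
   it uses one crossing edge and at most two edges [s - i - t] on one side. *)
Lemma label_walk_meet s t p :
  path label_adj (false, inl s) p -> last (false, inl s) p = (true, inl t) ->
  (size p <= 4)%N -> s = t \/ exists i, nth false s i && nth false t i.
Proof.
(* All shapes of walks with at most four steps are enumerated; adjacency excludes a shape,
   identifies [s] with [t], or exhibits a common element. *)
move: p => [|[b1 [s1|i1]] [|[b2 [s2|i2]] [|[b3 [s3|i3]] [|[b4 [s4|i4]] []]]]] //=;
  rewrite /label_adj /= ?andbT ?andbF // => + [*]; intros; subst;
  repeat match goal with
  | b : bool |- _ => destruct b => //=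
  | H : is_true (_ && _) |- _ => case/andP: H => ? ?
  | H : is_true (_ == _) |- _ => move/eqP: H => ?; subst
  | |- ?a = ?a \/ _ => by left
  | H : is_true (nth _ ?s ?i), K : is_true (nth _ ?t ?i) |- ?s = ?t \/ _ =>
      by right; exists i; rewrite H K
  end => //.
Qed.

(** * The blow-up and its minimum degree *)

(* Sparse sets are replaced by the full set, so that every label has linear degree. *)
Definition saturate (d : nat) (s : bitseq) : bitseq :=
  if (d <= 16 * count id s)%N then s else nseq d true.

Lemma size_saturate d s : size s = d -> size (saturate d s) = d.
Proof. by rewrite /saturate; case: ifP; rewrite ?size_nseq. Qed.

Lemma count_saturate d s : (d <= 16 * count id (saturate d s))%N.
Proof. by rewrite /saturate; case: ifP => //; rewrite count_nseq; lia. Qed.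

Lemma saturate_nth d s i :
  (i < d)%N -> nth false s i -> nth false (saturate d s) i.
Proof. by rewrite /saturate; case: ifP => // _ id; rewrite nth_nseq id. Qed.

(* The residue of [v] mod 4 selects the side and the kind of label. *)
Definition vlabel (d v : nat) : label :=
  (odd v, if odd (v %/ 2) then inr ((v %/ 4) %% d)%N
          else inl (saturate d (nth [::] (cube d) ((v %/ 4) %% 2 ^ d)))).

Lemma vlabel_set d q (b : bool) : (q < 2 ^ d)%N ->
  vlabel d (4 * q + b) = (b, inl (saturate d (nth [::] (cube d) q))).
Proof.
move=> qd; rewrite /vlabel.
have -> : odd (4 * q + b) = b by lia.
have -> : odd ((4 * q + b) %/ 2) = false by case: b; lia.
by have -> : ((4 * q + b) %/ 4 = q)%N by [case: b; lia]; rewrite modn_small.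
Qed.

Lemma vlabel_index d q (b : bool) :
  vlabel d (4 * q + (2 + b)) = (b, inr (q %% d)%N).
Proof.
rewrite /vlabel.
have -> : odd (4 * q + (2 + b)) = b by lia.
have -> : odd ((4 * q + (2 + b)) %/ 2) by case: b; lia.
by have -> : ((4 * q + (2 + b)) %/ 4 = q)%N by case: b; lia.
Qed.

Lemma nth_cube_mem d q : (nth [::] (cube d) (q %% 2 ^ d)) \in cube d.
Proof. by rewrite mem_nth // size_cube ltn_mod expn_gt0. Qed.

Definition blowup_adj (N d : nat) : rel 'I_N :=
  fun x y => label_adj (vlabel d x) (vlabel d y).

Lemma blowup_adj_sym N d : symmetric (@blowup_adj N d).
Proof. by move=> x y; apply: label_adj_sym. Qed.

Lemma blowup_adj_irr N d : irreflexive (@blowup_adj N d).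
Proof. by move=> x; apply: label_adj_irr. Qed.

Lemma blowup_adj_vset N d (x y : 'I_N) :
  blowup_adj d x y -> (x \in [set: 'I_N]%SET) && (y \in [set: 'I_N]%SET).
Proof. by rewrite !inE. Qed.

Definition blowup (N d : nat) : graph 'I_N :=
  Graph (@blowup_adj_sym N d) (@blowup_adj_irr N d) (@blowup_adj_vset N d).

(** Among the indices below [2 ^ d], the full blocks of length [d] fill at least half, and each
    block yields [#|s| >= d / 16] neighbours. This gives at least [2 ^ d / 32 > N / 256]. *)
Lemma blowup_degree_set N d (x : 'I_N) b s :
  (0 < d)%N -> (4 * 2 ^ d <= N)%N -> (N < 8 * 2 ^ d)%N ->
  vlabel d x = (b, inl s) -> size s = d -> (d <= 16 * count id s)%N ->
  (N <= 256 * degree (blowup N d) x)%N.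
Proof.
move=> d_gt0 N_ge N_lt xs sz cs; rewrite /degree /= /blowup_adj xs.
have b4 : (2 + b < 4)%N by case: b {xs}.
have := card_ord_count (fun v => label_adj (b, inl s) (vlabel d v)) b4 N_ge.
move: #|_| => D; rewrite (@eq_count _ _ (fun q => nth false s (q %% d))); last first.
  by move=> q; rewrite vlabel_index /label_adj /= eqxx.
have mle : (2 ^ d %/ d * d <= 2 ^ d)%N by exact: leq_trunc_div.
rewrite -(subnKC mle) iotaD count_cat count_iota_modn // => h.
have : (2 ^ d < (2 ^ d %/ d).+1 * d)%N by exact: ltn_ceil.
have : (2 * d <= 2 ^ d)%N.
  by rewrite -(prednK d_gt0) expnS leq_mul2l ltn_expl.
have : (2 ^ d %/ d * d <= 2 ^ d %/ d * (16 * count id s))%N.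
  by rewrite leq_mul2l cs orbT.
by move: N_lt h; rewrite mulSn; lia.
Qed.

(** Half of all sets contain [i], and saturation keeps [i] in them, so there are at least
    [2 ^ d / 2 > N / 16] neighbours. *)
Lemma blowup_degree_index N d (x : 'I_N) b i :
  (4 * 2 ^ d <= N)%N -> (N < 8 * 2 ^ d)%N ->
  vlabel d x = (b, inr i) -> (i < d)%N -> (N <= 256 * degree (blowup N d) x)%N.
Proof.
move=> N_ge N_lt xi ltid; rewrite /degree /= /blowup_adj xi.
have b4 : (b < 4)%N by case: b {xi}.
have := card_ord_count (fun v => label_adj (b, inr i) (vlabel d v)) b4 N_ge.
move: #|_| => D; apply: contraLR; rewrite -!ltnNge => DN.
have := count_cube_nth ltid.
rewrite -[in count _ _](mkseq_nth [::] (cube d)) /mkseq count_map size_cube.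
suff : (count (preim (nth [::] (cube d)) (fun s => nth false s i)) (iota 0 (2 ^ d)) <=
   count (fun q => label_adj (b, inr i) (vlabel d (4 * q + b))) (iota 0 (2 ^ d)))%N.
  by move: N_lt; lia.
rewrite -!size_filter uniq_leq_size ?filter_uniq ?iota_uniq // => q.
rewrite !mem_filter mem_iota => /andP[/= qi qd]; rewrite qd andbT.
by rewrite vlabel_set // /label_adj /= eqxx saturate_nth.
Qed.

Lemma blowup_min_degree N d :
  (0 < d)%N -> (4 * 2 ^ d <= N)%N -> (N < 8 * 2 ^ d)%N ->
  (N <= 256 * min_degree (blowup N d))%N.
Proof.
move=> d_gt0 N_ge N_lt.
rewrite /min_degree; elim/big_ind: _ => [|m n hm hn|x _].
- by rewrite /= cardsT card_ord; lia.
- by rewrite /minn; case: ifP.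
have := erefl (vlabel d x); rewrite [in RHS]/vlabel; case: ifP => _ xl.
  by apply: blowup_degree_index N_ge N_lt xl _; rewrite ltn_mod.
apply: blowup_degree_set d_gt0 N_ge N_lt xl _ (count_saturate _ _).
by apply/size_saturate/eqP; rewrite -mem_cube nth_cube_mem.
Qed.

(** * Bounded diameter, the bound on [k], and the contradiction *)

Lemma diam_path (R : realType) (T : finType) (H : graph T) n x y :
  (diam R H <= n%:R%:E)%E -> x \in vset H -> y \in vset H ->
  exists p, [/\ path (adj H) x p, last x p = y & (size p <= n)%N].
Proof.
move=> dH xH yH.
have : (dist R H x y <= n%:R%:E)%E.
  apply: le_trans dH; rewrite /diam.
  apply: le_trans (le_bigmax_cond _ _ xH).
  exact: (le_bigmax_cond _ (fun y => dist R H x y) yH).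
(* An infimum below [n + 1] yields a walk of length below [n + 1], hence at most [n]. *)
move=> dxy; have : (dist R H x y < n.+1%:R%:E)%E.
  by apply: le_lt_trans dxy _; rewrite lte_fin ltr_nat.
move=> /ereal_inf_lt[_ [p [pp lp] <-]]; rewrite lte_fin ltr_nat ltnS => sp.
by exists p.
Qed.

Lemma pow4_le (R : realType) (k N : nat) : (0 < N)%N ->
  k%:R <= 1 / 2 * log2 (N%:R : R) -> (4 ^ k <= N)%N.
Proof.
move=> N0; rewrite /log2 => kN.
have ln2 : 0 < ln 2 :> R by rewrite ln_gt0 // ltr1n.
rewrite -(ler_nat R) -ler_ln ?posrE ?ltr0n ?expn_gt0 //.
rewrite (_ : 4 ^ k = 2 ^ (2 * k))%N; last by rewrite expnM.
rewrite natrX lnXn //.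
rewrite -[leLHS]mulr_natl natrM.
move: kN; rewrite mulrA ler_pdivlMr // mul1r => kN.
have := ler_wpM2l (ler0n R 2) kN.
by rewrite !mulrA divff ?mul1r // pnatr_eq0.
Qed.

Theorem theorem3p2 (R : realType) :
  exists N0 : nat, forall N : nat, (N0 <= N)%N ->
    exists G : graph 'I_N,
      [/\ vset G = [set: 'I_N]%SET,
          2 ^- 8 * N%:R <= (min_degree G)%:R :> R
        & forall (k : nat) (H : 'I_k -> graph 'I_N),
            k%:R <= 1 / 2 * log2 (N%:R : R) ->
            (forall i : 'I_k, subgraph (H i) G) ->
            (forall i : 'I_k, (diam R (H i) <= 4%:R%:E)%E) ->
            ~ covers_edges G H].
Proof.
(* This makes [d = trunc_log 2 N - 2] at least 12, as [count_cube_sparse] requires. *)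
exists (2 ^ 14)%N => N N14.
have N0 : (0 < N)%N by apply: leq_trans N14; rewrite expn_gt0.
have log14 : (14 <= trunc_log 2 N)%N by apply: trunc_log_max N14.
have /andP[] := trunc_log_bounds (ltnSn 1) N0.
have [d d12 ->] : exists2 d, (12 <= d)%N & trunc_log 2 N = (d + 2)%N.
  by exists (trunc_log 2 N - 2)%N; lia.
rewrite -addnS !expnD mulnC => N_ge; rewrite mulnC => N_lt.
have d_gt0 : (0 < d)%N by lia.
exists (blowup N d); split=> //.
  rewrite ler_pdivrMl ?exprn_gt0 // -natrX -natrM ler_nat.
  exact: blowup_min_degree.
move=> k H /(pow4_le N0) kN subH diamH cov.
have special s : size s = d -> (d <= 16 * count id s)%N ->
    exists u v : 'I_N, vlabel d u = (false, inl s) /\ vlabel d v = (true, inl s).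
  move=> /eqP; rewrite -mem_cube => sd cs.
  have qd : (index s (cube d) < 2 ^ d)%N by rewrite -size_cube index_mem.
  have lab (b : bool) : vlabel d (4 * index s (cube d) + b) = (b, inl s).
    by rewrite vlabel_set // nth_index // /saturate cs.
  have ub (b : bool) : (4 * index s (cube d) + b < N)%N by lia.
  by exists (Ordinal (ub false)), (Ordinal (ub true)); split; exact: lab.
(* The dense sets having a crossing edge in [H i]. *)
pose F (i : 'I_k) : pred bitseq := fun s => (d <= 16 * count id s)%N &&
  [exists u : 'I_N, [exists v : 'I_N, [&& vlabel d u == (false, inl s),
     vlabel d v == (true, inl s) & adj (H i) u v]]].
have intF i : intersecting d (F i).
  move=> s t _ _ /andP[cs /existsP[u /existsP[v /and3P[/eqP us _ uv]]]].
  move=> /andP[_ /existsP[w /existsP[z /and3P[_ /eqP zt wz]]]].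
  have /andP[uH _] := adj_vset uv; have /andP[_ zH] := adj_vset wz.
  (* A short walk from the left end of an edge for [s] to the right end of an edge for [t]; its
     labels are fed to [label_walk_meet]. *)
  have [p [pp lp sp]] := diam_path (diamH i) uH zH.
  pose f (x : 'I_N) := vlabel d x.
  have := @label_walk_meet s t (map f p).
  rewrite -us -/(f u) last_map lp size_map path_map => /(_ _ zt sp)[|<-|] //.
    by apply: sub_path pp; have [_] := subH i.
  (* If [s = t], a common element exists because dense sets are nonempty for [d > 0]. *)
  have /hasP[b bs bt] : has id s by rewrite has_count; lia.
  by exists (index b s); rewrite !nth_index ?andbb.
have := kleitman intF; rewrite leqNgt => /negP; apply.
apply: leq_ltn_trans (count_cube_sparse d12 (k := k) _); last first.
  by apply: leq_ltn_trans kN _; rewrite expnD mulnC.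
(* A dense set outside every [F i] would have an uncovered crossing edge, so all missed sets are
   sparse. *)
rewrite leq_mul2l; apply/orP; right.
rewrite -!size_filter uniq_leq_size ?filter_uniq ?cube_uniq // => s.
rewrite !mem_filter mem_cube => /andP[/forallP nF /eqP sd].
rewrite sd eqxx andbT ltnNge; apply/negP => cs.
have [u [v [us vs]]] := special s sd cs.
have [|i uv] := cov u v; first by rewrite /= /blowup_adj us vs /label_adj /= eqxx.
move/negP: (nF i); apply; rewrite /F cs; apply/existsP; exists u.
by apply/existsP; exists v; rewrite us vs !eqxx.
Qed.
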